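(* For every group $G$ there exist infinitely many pairwise non-homotopy-equivalent Alexandroff spaces $X$ such that the group $\mathcal{E}(X)$ is isomorphic to $G$.
   Context: An Alexandroff space is a topological space in which arbitrary intersections of open sets are open. For a topological space $X$, $\mathcal{E}(X)$ denotes the group of (free) homotopy classes of self-homotopy equivalences $X\to X$, with the operation induced by composition; equivalently, the automorphism group of $X$ in the homotopy category of topological spaces. *)

(* Defs.v *)
From HB Require Import structures.
From mathcomp Require Import all_boot all_order all_algebra generic_quotient.
From mathcomp Require Import all_classical reals topology.
From mathcomp Require Import normedtype.

Set Implicit Arguments.
Unset Strict Implicit.
Unset Printing Implicit Defensive.

Import Order.TTheory GRing.Theory Num.Theory.
Import numFieldNormedType.Exports.

Local Open Scope classical_set_scope.
Local Open Scope ring_scope.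
Local Open Scope quotient_scope.

Definition alexandroff (X : topologicalType) : Prop :=
  forall F : set (set X), F `<=` open -> open (\bigcap_(U in F) U).

(* A homotopy X x [0, 1] -> Y is given as a function on X * R, of which only
   the restriction to X x [0, 1], with the subspace topology, is relevant. *)
Definition homotopic (R : realType) (X Y : topologicalType) (f g : X -> Y) :
    Prop :=
  exists H : X * R -> Y,
    [/\ {within [set: X] `*` `[0, 1], continuous H},
        forall x, H (x, 0) = f x
      & forall x, H (x, 1) = g x].

Definition homotopy_inverse (R : realType) (X Y : topologicalType)
    (f : X -> Y) (g : Y -> X) : Prop :=
  homotopic R (g \o f) idfun /\ homotopic R (f \o g) idfun.

Definition homotopy_equivalence (R : realType) (X Y : topologicalType)
    (f : continuousType X Y) : Prop :=
  exists g : continuousType Y X, homotopy_inverse R f g.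

Definition homotopy_equivalent (R : realType) (X Y : topologicalType) : Prop :=
  exists f : continuousType X Y, homotopy_equivalence R f.

Section homotopy_theory.
Variable R : realType.

Lemma within_continuous_precomp (S T U : topologicalType) (A : set S)
    (B : set T) (k : S -> T) (h : T -> U) :
  continuous k -> (forall x, A x -> B (k x)) ->
  {within B, continuous h} -> {within A, continuous (h \o k)}.
Proof.
move=> ck kAB /continuousP ch; apply/continuousP => W oW.
have /open_subspaceP[V oV VB] := ch W oW.
apply/open_subspaceP; exists (k @^-1` V).
  by move/continuousP: ck; apply.
apply/seteqP; split=> x [/= Vx Ax]; split=> //.
- have : (V `&` B) (k x) by split=> //; exact: kAB.
  by rewrite VB => -[].
- have : ((h @^-1` W) `&` B) (k x) by split=> //; exact: kAB.
  by rewrite -VB => -[].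
Qed.

Lemma homotopic_refl (X Y : topologicalType) (f : X -> Y) :
  continuous f -> homotopic R f f.
Proof.
move=> cf; exists (f \o fst); split=> //.
apply: continuous_subspaceT => z.
by apply: continuous_comp; [exact: cvg_fst|exact: cf].
Qed.

Lemma reparam_continuous (X : topologicalType) (p : R -> R) :
  continuous p -> continuous (fun z : X * R => (z.1, p z.2)).
Proof.
move=> cp z; apply: (@cvg_pair _ _ _ _ (nbhs z.1) (nbhs (p z.2))).
  exact: cvg_fst.
by apply: (@continuous_comp _ _ _ snd p); [exact: cvg_snd|exact: cp].
Qed.

Lemma homotopic_sym (X Y : topologicalType) (f g : X -> Y) :
  homotopic R f g -> homotopic R g f.
Proof.
move=> [H [cH H0 H1]]; exists (H \o (fun z => (z.1, 1 - z.2))); split=> /=.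
- apply: within_continuous_precomp cH.
    apply: (@reparam_continuous _ (fun t => 1 - t)) => t.
    by apply: cvgB; [exact: cvg_cst|exact: cvg_id].
  move=> [x t] /= [_]; rewrite !in_itv/= => /andP[t0 t1]; split=> //.
  by rewrite subr_ge0 t1 lerBlDr lerDl.
- by move=> x; rewrite subr0.
- by move=> x; rewrite subrr.
Qed.

Lemma homotopic_trans (X Y : topologicalType) (f g h : X -> Y) :
  homotopic R f g -> homotopic R g h -> homotopic R f h.
Proof.
move=> [H [cH H0 H1]] [K [cK K0 K1]].
pose L (z : X * R) := if z.2 <= 2^-1 then H (z.1, 2 * z.2)
                      else K (z.1, 2 * z.2 - 1).
have h1 : (2 * 2^-1 = 1 :> R) by rewrite mulfV ?pnatr_eq0.
exists L; split; last 2 first.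
- by move=> x; rewrite /L/= invr_ge0 ler0n mulr0 H0.
- move=> x; rewrite /L/= ifF ?mulr1; last first.
    by apply/negbTE; rewrite -ltNge invf_lt1 ?ltr1n.
  by rewrite -K1; congr (K (_, _)); rewrite -[2]/(1 + 1 : R) addrK.
pose A := [set: X] `*` [set t : R | 0 <= t <= 2^-1].
pose B := [set: X] `*` [set t : R | 2^-1 <= t <= 1].
have clo (a b : R) : closed ([set: X] `*` [set t : R | a <= t <= b]).
  rewrite (_ : _ `*` _ = snd @^-1` [set` `[a, b]]).
    by apply: closed_comp => [? _|]; [exact: cvg_snd|exact: interval_closed].
  by apply/seteqP; split=> -[x t] /=; rewrite in_itv/=; [case|].
have -> : [set: X] `*` `[0, 1] = A `|` B.
  apply/seteqP; split=> -[x t] /=; rewrite in_itv /=.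
    by move=> [_ /andP[t0 t1]]; case: (leP t 2^-1) => ht; [left|right];
       split=> //=; apply/andP; split=> //; exact: ltW.
  move=> [] [_ /= /andP[a b]]; split=> //; apply/andP; split=> //.
    by rewrite (le_trans b)// invf_le1 ?ler1n.
  by rewrite (le_trans _ a)// invr_ge0.
apply: withinU_continuous; [exact: clo|exact: clo| |].
- have : {within A, continuous (H \o (fun z => (z.1, 2 * z.2)))}.
    apply: within_continuous_precomp cH.
      apply: (@reparam_continuous _ (fun t => 2 * t)) => t.
      by apply: cvgM; [exact: cvg_cst|exact: cvg_id].
    move=> [x t] [_ /= /andP[a b]]; split=> //=; rewrite in_itv/= mulr_ge0//=.
    by rewrite -[leRHS]h1 ler_pM2l.
  apply: subspace_eq_continuous => -[x t]; rewrite inE => -[_ /= /andP[_ ht]].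
  by rewrite /from_subspace /L /= ht.
- have : {within B, continuous (K \o (fun z => (z.1, 2 * z.2 - 1)))}.
    apply: within_continuous_precomp cK.
      apply: (@reparam_continuous _ (fun t => 2 * t - 1)) => t.
      apply: cvgB; last exact: cvg_cst.
      by apply: cvgM; [exact: cvg_cst|exact: cvg_id].
    move=> [x t] [_ /= /andP[a b]]; split=> //=; rewrite in_itv/= subr_ge0.
    rewrite -[X in X <= _]h1 ler_pM2l// a/= lerBlDr -[1 + 1]/(2 : R).
    by rewrite ger_pMr.
  apply: subspace_eq_continuous => -[x t]; rewrite inE => -[_ /= /andP[ht _]].
  rewrite /from_subspace /L /=; case: ifPn => //= ht'.
  have -> : t = 2^-1 by apply/le_anti; rewrite ht ht'.
  by rewrite h1 subrr H1 K0.
Qed.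

Lemma homotopic_comp (X Y Z : topologicalType) (f f' : X -> Y) (g g' : Y -> Z) :
  continuous f -> continuous g' ->
  homotopic R f f' -> homotopic R g g' -> homotopic R (g \o f) (g' \o f').
Proof.
move=> cf cg' [H [cH H0 H1]] [K [cK K0 K1]].
apply: (@homotopic_trans _ _ _ (g' \o f)).
  exists (K \o (fun z => (f z.1, z.2))); split=> /=.
  - apply: within_continuous_precomp cK.
      move=> z; apply: (@cvg_pair _ _ _ _ (nbhs (f z.1)) (nbhs z.2)).
        by apply: (@continuous_comp _ _ _ fst f); [exact: cvg_fst|exact: cf].
      exact: cvg_snd.
    by move=> [x t] [].
  - by move=> x; rewrite K0.
  - by move=> x; rewrite K1.
exists (g' \o H); split=> /=.
- move=> z; apply: (@continuous_comp (subspace _) _ _ H g').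
    exact: cH.
  exact: cg'.
- by move=> x; rewrite H0.
- by move=> x; rewrite H1.
Qed.

End homotopy_theory.

Definition selfHequiv (R : realType) (X : topologicalType) : Type :=
  {f : continuousType X X | `[< homotopy_equivalence R f >]}.

HB.instance Definition _ (R : realType) (X : topologicalType) :=
  Choice.on (selfHequiv R X).

Section self_homotopy_equivalences.
Variables (R : realType) (X : topologicalType).
Local Notation S := (selfHequiv R X).
Implicit Types f g h : S.

Let she_homotopic f g : bool := `[< homotopic R (val f) (val g) >].

Let she_homotopic_refl : reflexive she_homotopic.
Proof. by move=> f; apply/asboolP/homotopic_refl/cts_fun. Qed.

Let she_homotopic_sym : symmetric she_homotopic.
Proof. by move=> f g; apply/asboolP/asboolP; apply: homotopic_sym. Qed.

Let she_homotopic_trans : transitive she_homotopic.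
Proof.
move=> f g h /asboolP gf /asboolP fh; apply/asboolP.
exact: homotopic_trans gf fh.
Qed.

Definition selfHequiv_rel : equiv_rel S :=
  EquivRel she_homotopic she_homotopic_refl she_homotopic_sym
    she_homotopic_trans.

Definition selfHE := {eq_quot selfHequiv_rel}.
HB.instance Definition _ := Choice.on selfHE.
HB.instance Definition _ := Quotient.on selfHE.

Lemma selfHE_eqP f g :
  \pi_selfHE f = \pi_selfHE g <-> homotopic R (val f) (val g).
Proof.
split; first by move/eqmodP => /asboolP.
by move=> fg; apply/eqmodP/asboolP.
Qed.

Lemma selfHequiv_idP :
  `[< homotopy_equivalence R (idfun : continuousType X X) >].
Proof.
by apply/asboolP; exists idfun; split; apply: homotopic_refl => x; apply: cvg_id.
Qed.

Definition selfHequiv_id : S :=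
  exist _ (idfun : continuousType X X) selfHequiv_idP.

Lemma selfHequiv_compP f g :
  `[< homotopy_equivalence R (val f \o val g : continuousType X X) >].
Proof.
case: f g => [f /asboolP[f' [f'f ff']]] [g /asboolP[g' [g'g gg']]] /=.
apply/asboolP; exists (g' \o f'); split.
- apply: homotopic_trans g'g.
  apply: (@homotopic_comp _ _ _ _ g g ((g' \o f') \o f) g'); try exact: cts_fun.
    exact/homotopic_refl/cts_fun.
  apply: (@homotopic_comp _ _ _ _ (f' \o f) idfun g' g') => //;
    try exact: cts_fun.
  exact/homotopic_refl/cts_fun.
- apply: homotopic_trans ff'.
  apply: (@homotopic_comp _ _ _ _ f' f' ((f \o g) \o g') f); try exact: cts_fun.
    exact/homotopic_refl/cts_fun.
  apply: (@homotopic_comp _ _ _ _ (g \o g') idfun f f) => //;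
    try exact: cts_fun.
  exact/homotopic_refl/cts_fun.
Qed.

Definition selfHequiv_comp f g : S :=
  exist _ (val f \o val g : continuousType X X) (selfHequiv_compP f g).

Lemma selfHequiv_inv_ex f :
  exists g : S, homotopy_inverse R (val f) (val g).
Proof.
have /asboolP[g fg] := valP f.
have gP : `[< homotopy_equivalence R g >].
  by apply/asboolP; exists (val f); case: fg.
by exists (exist _ g gP).
Qed.

Definition selfHequiv_inv f : S := sval (cid (selfHequiv_inv_ex f)).

Lemma selfHequiv_invP f :
  homotopy_inverse R (val f) (val (selfHequiv_inv f)).
Proof. exact: svalP (cid (selfHequiv_inv_ex f)). Qed.

Definition selfHE_one : selfHE := \pi_selfHE selfHequiv_id.

Definition selfHE_mul (a b : selfHE) : selfHE :=
  \pi_selfHE (selfHequiv_comp (repr a) (repr b)).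

Definition selfHE_inv (a : selfHE) : selfHE :=
  \pi_selfHE (selfHequiv_inv (repr a)).

Lemma selfHE_mul_pi f g :
  selfHE_mul (\pi_selfHE f) (\pi_selfHE g) = \pi_selfHE (selfHequiv_comp f g).
Proof.
apply/selfHE_eqP => /=; apply: homotopic_comp; try exact: cts_fun.
- by apply/selfHE_eqP; rewrite reprK.
- by apply/selfHE_eqP; rewrite reprK.
Qed.

Lemma selfHE_mulA : associative selfHE_mul.
Proof.
elim/quotW=> f; elim/quotW=> g; elim/quotW=> h.
rewrite (selfHE_mul_pi f g) (selfHE_mul_pi g h) !selfHE_mul_pi.
apply/selfHE_eqP; apply: (@homotopic_refl _ _ _ (val f \o (val g \o val h))).
exact: cts_fun.
Qed.

Lemma selfHE_mul1r : left_id selfHE_one selfHE_mul.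
Proof.
elim/quotW=> f; rewrite selfHE_mul_pi.
apply/selfHE_eqP; apply: (@homotopic_refl _ _ _ (val f)).
exact: cts_fun.
Qed.

Lemma selfHE_mulr1 : right_id selfHE_one selfHE_mul.
Proof.
elim/quotW=> f; rewrite selfHE_mul_pi.
apply/selfHE_eqP; apply: (@homotopic_refl _ _ _ (val f)).
exact: cts_fun.
Qed.

Lemma selfHE_mulVr : left_inverse selfHE_one selfHE_inv selfHE_mul.
Proof.
move=> a; rewrite -[a in X in selfHE_mul _ X]reprK selfHE_mul_pi.
by apply/selfHE_eqP; case: (selfHequiv_invP (repr a)).
Qed.

Lemma selfHE_mulrV : right_inverse selfHE_one selfHE_inv selfHE_mul.
Proof.
move=> a; rewrite -[a in X in selfHE_mul X _]reprK selfHE_mul_pi.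
by apply/selfHE_eqP; case: (selfHequiv_invP (repr a)).
Qed.

HB.instance Definition _ := isGroup.Build selfHE
  selfHE_mulA selfHE_mul1r selfHE_mulr1 selfHE_mulVr selfHE_mulrV.

End self_homotopy_equivalences.

Definition group_isomorphic (G H : groupType) : Prop :=
  exists2 phi : G -> H, {morph phi : x y / (x * y)%g} & bijective phi.

(* Main.v *)
Require Import Defs.
From HB Require Import structures.
From mathcomp Require Import all_boot all_order all_algebra generic_quotient.
From mathcomp Require Import all_classical reals topology normedtype.
From mathcomp Require Import wochoice.

(* Points [inl b] and [inr t] of an incidence space form a poset of height one,
   and the open sets are the down-sets. Let b, b' < t, t' be a crown, i.e. a
   4-cycle of the incidence graph, and let H be a homotopy starting at the
   identity. As the H_s are monotone, H_s fixes the crown as soon as H_s x <= x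
   on it, and also as soon as x <= H_s x on it. The first condition is open in s
   and the second one closed, so H_s fixes the crown for all s. Hence, if every
   point lies on a crown, homotopic self-equivalences are equal and homotopy
   equivalences are isomorphisms.
   It remains to find infinitely many height-one posets with automorphism group
   G. Well-order G and append a finite tail of n + 2 elements; the cuts of this
   order form a poset without nontrivial automorphisms, which determines n. Its
   elements serve as colours: a maximal point is attached to each pair (g, h),
   joined to the colour g^-1 h, so that the automorphisms are exactly the left
   translations of G. *)

Set Implicit Arguments.
Unset Strict Implicit.
Unset Printing Implicit Defensive.

Import Order.TTheory GRing.Theory Num.Theory.
Import numFieldNormedType.Exports.

Local Open Scope classical_set_scope.

(** * Continuity of the slices of a product *)

Section pair_continuity.
Variables S T : topologicalType.

Lemma pairl_continuous (x : S) : continuous (fun y : T => (x, y)).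
Proof.
by move=> y; apply: (cvg_pair (G := nbhs x)); [exact: cvg_cst|exact: cvg_id].
Qed.

Lemma pairr_continuous (y : T) : continuous (fun x : S => (x, y)).
Proof.
by move=> x; apply: (cvg_pair (H := nbhs y)); [exact: cvg_id|exact: cvg_cst].
Qed.

End pair_continuity.

(** * Incidence spaces: the down-set topology, continuous maps and crowns *)

Definition incidence_space (B T : Type) (I : B -> T -> Prop) : Type := B + T.

Section incidence_topology.
Variables (B T : Type) (I : B -> T -> Prop).
Local Notation X := (incidence_space I).

HB.instance Definition _ := gen_eqMixin X.
HB.instance Definition _ := gen_choiceMixin X.

Definition incidence_le (x y : X) : Prop :=
  x = y \/ if (x, y) is (inl b, inr t) then I b t else False.

Let down_closed (U : set X) : Prop :=
  forall x y, incidence_le x y -> U y -> U x.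

Let down_closedT : down_closed setT.
Proof. by []. Qed.

Let down_closedI : setI_closed down_closed.
Proof.
by move=> U V dU dV x y xy [Uy Vy]; split; [exact: dU Uy|exact: dV Vy].
Qed.

Let down_closed_bigU (J : Type) (F : J -> set X) :
  (forall j, down_closed (F j)) -> down_closed (\bigcup_j F j).
Proof. by move=> dF x y xy [j _ Fy]; exists j => //; exact: dF xy Fy. Qed.

HB.instance Definition _ :=
  isOpenTopological.Build X down_closedT down_closedI down_closed_bigU.

Lemma open_incidenceE (U : set X) :
  open U = forall x y, incidence_le x y -> U y -> U x.
Proof. by []. Qed.

Lemma incidence_le_refl (x : X) : incidence_le x x.
Proof. by left. Qed.

Lemma incidence_le_trans (y x z : X) :
  incidence_le x y -> incidence_le y z -> incidence_le x z.
Proof.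
move=> [->//|xy] [<-|yz]; first by right.
by case: x y z xy yz => [?|?] [?|?] [?|?].
Qed.

Lemma incidence_lebt b t : incidence_le (inl b) (inr t) <-> I b t.
Proof. by split=> [[]|]//; right. Qed.

Lemma incidence_le_inl x b : incidence_le x (inl b) -> x = inl b.
Proof. by case=> //; case: x. Qed.

Lemma incidence_inr_le t y : incidence_le (inr t) y -> y = inr t.
Proof. by case=> //; case: y. Qed.

Lemma open_down (x : X) : open [set y | incidence_le y x].
Proof.
rewrite open_incidenceE => y z yz /= zx; exact: incidence_le_trans zx.
Qed.

Lemma closed_up (x : X) : closed [set y | incidence_le x y].
Proof.
rewrite -openC open_incidenceE => y z yz /= xz xy.
by apply: xz; exact: incidence_le_trans yz.
Qed.

Lemma alexandroff_incidence : alexandroff X.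
Proof.
move=> F Fo; rewrite open_incidenceE => x y xy Fy U FU.
by have := Fo _ FU; rewrite open_incidenceE; apply; [exact: xy|exact: Fy].
Qed.

Lemma continuous_incidenceP (Y : topologicalType) (f : X -> Y) :
  continuous f <->
  forall U, open U -> forall x y, incidence_le x y -> U (f y) -> U (f x).
Proof. by split=> [/continuousP//|h]; apply/continuousP. Qed.

Definition crown (b b' : B) (t t' : T) : Prop :=
  (b <> b' /\ t <> t') /\ [/\ I b t, I b t', I b' t & I b' t'].

Definition crown_points (b b' : B) (t t' : T) : set X :=
  [set inl b; inl b'; inr t; inr t'].

(** Bottom points are minimal, so they cannot move down. The image of a top point stays above both
    [inl b] and [inl b'], so it is not a bottom point, and the only top point below [inr t] is
    itself. *)
Lemma crown_le_fixed (b b' : B) (t t' : T) (f : X -> X) : crown b b' t t' ->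
    {homo f : x y / incidence_le x y} ->
    (forall x, crown_points b b' t t' x -> incidence_le (f x) x) ->
  forall x, crown_points b b' t t' x -> f x = x.
Proof.
move=> [[bb' tt'] [bt bt' b't b't']] fle fx.
have fb : f (inl b) = inl b by apply/incidence_le_inl/fx; do 3 left.
have fb' : f (inl b') = inl b'.
  by apply/incidence_le_inl/fx; left; left; right.
have top u : crown_points b b' t t' (inr u) -> I b u -> I b' u ->
    f (inr u) = inr u.
  move=> /fx fu /incidence_lebt/fle + /incidence_lebt/fle; rewrite fb fb'.
  move: fu; case: (f (inr u)) => [c _|v]; last by move/incidence_inr_le => ->.
  by move=> /incidence_le_inl[bc] /incidence_le_inl[b'c]; case: bb'; rewrite bc.
move=> x [[[->|->]|->]|->] //; apply: top => //; first by left; right.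
by right.
Qed.

(** Dual argument: top points are maximal, and the image of a bottom point stays below two distinct
    top points. *)
Lemma crown_ge_fixed (b b' : B) (t t' : T) (f : X -> X) : crown b b' t t' ->
    {homo f : x y / incidence_le x y} ->
    (forall x, crown_points b b' t t' x -> incidence_le x (f x)) ->
  forall x, crown_points b b' t t' x -> f x = x.
Proof.
move=> [[bb' tt'] [bt bt' b't b't']] fle fx.
have ft : f (inr t) = inr t by apply/incidence_inr_le/fx; left; right.
have ft' : f (inr t') = inr t' by apply/incidence_inr_le/fx; right.
have bot c : crown_points b b' t t' (inl c) -> I c t -> I c t' ->
    f (inl c) = inl c.
  move=> /fx fc /incidence_lebt/fle + /incidence_lebt/fle; rewrite ft ft'.
  move: fc; case: (f (inl c)) => [d|v _]; first by move/incidence_le_inl => ->.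
  by move=> /incidence_inr_le[vt] /incidence_inr_le[vt']; case: tt'; rewrite vt.
move=> x [[[->|->]|->]|->] //; apply: bot => //; first by do 3 left.
by left; left; right.
Qed.

End incidence_topology.

Arguments incidence_le {B T I} x y.

Section incidence_maps.
Variables (B T B' T' : Type) (I : B -> T -> Prop) (I' : B' -> T' -> Prop).
Local Notation X := (incidence_space I).
Local Notation X' := (incidence_space I').

Lemma continuous_incidence_homo (f : X -> X') :
  continuous f <-> {homo f : x y / incidence_le x y}.
Proof.
split=> [/continuous_incidenceP cf x y xy|fle].
  apply: (cf _ (@open_down _ _ _ (f y)) _ _ xy); exact: incidence_le_refl.
apply/continuous_incidenceP => U; rewrite open_incidenceE => dU x y xy.
by apply: dU; exact: fle.
Qed.

End incidence_maps.

(** * Rigidity of crowns under homotopies of the identity *)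

Section rigidity.
Variables (R : realType) (B T : Type) (I : B -> T -> Prop).
Local Notation X := (incidence_space I).

Lemma homotopy_fixes_crown (H : X * R -> X) (b b' : B) (t t' : T) :
    crown I b b' t t' -> {within [set: X] `*` `[0%R, 1%R], continuous H} ->
    (forall x, H (x, 0%R) = x) ->
  forall x, crown_points b b' t t' x -> H (x, 1%R) = x.
Proof.
move=> bt cH H0.
have Hle s : `[0%R, 1%R]%classic s ->
    {homo (fun x => H (x, s)) : x y / incidence_le x y}.
  move=> s01; apply/continuous_incidence_homo/continuous_subspace_setT.
  apply: (@within_continuous_precomp _ _ _ _ _ (fun x => (x, s)) H _ _ cH);
    last by [].
  exact: pairr_continuous.
have Hpath x : {within `[0%R, 1%R], continuous (fun s => H (x, s))}.
  apply: (@within_continuous_precomp _ _ _ _ _ (fun s => (x, s)) H _ _ cH);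
    last by [].
  exact: pairl_continuous.
(* Times at which [r] relates the image of each crown point to that point. Typing the set in the
   subspace makes open and closed relative to the unit interval. *)
pose fixing (r : X -> X -> Prop) : set (subspace `[0%R, 1%R]) :=
  `[0%R, 1%R] `&`
  \bigcap_(x in crown_points b b' t t') [set s | r (H (x, s)) x].
pose below := fixing incidence_le.
have below_fix : below = fixing eq.
  apply/seteqP; split=> s [s01 sle]; split=> // x Cx /=; last first.
    by rewrite sle//; exact: incidence_le_refl.
  exact: (crown_le_fixed bt (Hle s s01)).
have below_above : below = fixing (fun x y => incidence_le y x).
  rewrite below_fix; apply/seteqP; split=> s [s01 sle]; split=> // x Cx /=.
    by rewrite sle//; exact: incidence_le_refl.
  exact: (crown_ge_fixed bt (Hle s s01)).
suff : below 1%R.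
  by rewrite below_fix => -[_ fix1] x /fix1.
suff -> : below = `[0%R, 1%R]%classic by rewrite /= in_itv/= ler01 lexx.
apply: (clopen_connectedP _).1 => //.
- exact: segment_connected.
- split.
  (* Openness uses that a crown is finite: four preimages of principal down-sets are intersected. *)
  + rewrite /below /fixing; apply: openI; first exact: open_subspaceT.
    rewrite !bigcap_setU !bigcap_set1.
    have open_below x :=
      (continuousP _).1 (Hpath x) _ (@open_down _ _ I x).
    by do !apply: openI; exact: open_below.
  + rewrite below_above; apply: closedI; first exact: closed_subspaceT.
    apply: closed_bigI => x _.
    apply: (@preimage_closed _ _ _ [set y | incidence_le x y]).
      by move=> s _; exact: Hpath.
    exact: closed_up.
- by move=> s [].
- exists 0%R; rewrite below_fix; split=> [|x _]; last exact: H0.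
  by rewrite /= in_itv/= ler01 lexx.
Qed.

End rigidity.

(** * Homotopy equivalences between crowned spaces *)

Definition crowned (B T : Type) (I : B -> T -> Prop) : Prop :=
  forall x : incidence_space I, exists b b' t t',
    crown I b b' t t' /\ crown_points b b' t t' x.

Section crowned_homotopy.
Variables (R : realType) (B T : Type) (I : B -> T -> Prop).
Hypothesis crownedI : crowned I.
Local Notation X := (incidence_space I).

Lemma crowned_homotopic_id (f : X -> X) : homotopic R f idfun -> f =1 id.
Proof.
move=> /homotopic_sym[H [cH H0 H1]] x.
have [b [b' [t [t' [btI bt]]]]] := crownedI x.
by rewrite -H1; exact: (homotopy_fixes_crown btI cH H0 bt).
Qed.

(** With [k] a homotopy inverse of [f], both [k \o g] and [f \o k] are homotopic to the identity,
    hence equal to it, and g = f k g = f. *)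
Lemma crowned_homotopic_eq (f g : selfHequiv R X) :
  homotopic R (val f) (val g) -> val f =1 val g.
Proof.
move=> fg; have [kf fk] := selfHequiv_invP f.
set k := selfHequiv_inv f in kf fk.
have /crowned_homotopic_id kg : homotopic R (val k \o val g) idfun.
  apply: homotopic_trans kf; apply: homotopic_comp; try exact: cts_fun.
  - exact: homotopic_sym.
  - exact/homotopic_refl/cts_fun.
by move=> x; rewrite -[in LHS](kg x)/=; exact: (crowned_homotopic_id fk).
Qed.

End crowned_homotopy.

Definition incidence_iso (B T B' T' : Type) (I : B -> T -> Prop)
    (I' : B' -> T' -> Prop) (fb : B -> B') (gb : B' -> B) (ft : T -> T')
    (gt : T' -> T) : Prop :=
  [/\ cancel fb gb, cancel gb fb, cancel ft gt, cancel gt ft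
    & forall b t, I b t <-> I' (fb b) (ft t)].

Lemma incidence_iso_sym (B T B' T' : Type) (I : B -> T -> Prop)
    (I' : B' -> T' -> Prop) fb gb ft gt :
  incidence_iso I I' fb gb ft gt -> incidence_iso I' I gb fb gt ft.
Proof.
by case=> fbK gbK ftK gtK ft_I; split=> // b t; rewrite ft_I gbK gtK.
Qed.

Section crowned_isomorphism.
Variables (B T B' T' : Type) (I : B -> T -> Prop) (I' : B' -> T' -> Prop).
Local Notation X := (incidence_space I).
Local Notation X' := (incidence_space I').

(** Injectivity keeps an incident pair strictly comparable, and in height one this determines the
    levels of its two images. Every point belongs to such a pair because it lies on a crown. *)
Lemma crowned_homo_levels (f : X -> X') : crowned I -> injective f ->
    {homo f : x y / incidence_le x y} ->
  exists fb ft, [/\ forall b, f (inl b) = inl (fb b),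
    forall t, f (inr t) = inr (ft t) & forall b t, I b t -> I' (fb b) (ft t)].
Proof.
move=> cI finj fle.
have fI b t : I b t ->
    exists b' t', [/\ f (inl b) = inl b', f (inr t) = inr t' & I' b' t'].
  move=> /incidence_lebt/fle[/finj//|].
  case: (f (inl b)) => // b'; case: (f (inr t)) => // t' b't'.
  by exists b', t'.
have /choice[fb fbE] : forall b, exists b', f (inl b) = inl b'.
  move=> b; have [c [c' [t [t' [[_ [ct _ c't _]]]]]]] := cI (inl b).
  by move=> [[[[->]|[->]]|//]|//]; [move: ct|move: c't] => /fI[b' [? []]];
    exists b'.
have /choice[ft ftE] : forall t, exists t', f (inr t) = inr t'.
  move=> t; have [c [c' [u [u' [[_ [cu cu' _ _]]]]]]] := cI (inr t).
  by move=> [[[|]//|[->]]|[->]]; [move: cu|move: cu'] => /fI[? [t' []]];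
    exists t'.
exists fb, ft; split=> // b t /fI[b' [t' []]].
by rewrite fbE ftE => -[->] [->].
Qed.

End crowned_isomorphism.

Lemma homotopy_inverse_incidence_iso (B T B' T' : Type)
    (I : B -> T -> Prop) (I' : B' -> T' -> Prop) (R : realType)
    (f : continuousType (incidence_space I) (incidence_space I'))
    (g : continuousType (incidence_space I') (incidence_space I)) :
    crowned I -> crowned I' -> homotopy_inverse R f g ->
  exists fb gb ft gt, [/\ incidence_iso I I' fb gb ft gt,
    forall b, f (inl b) = inl (fb b) & forall t, f (inr t) = inr (ft t)].
Proof.
move=> cI cI' [gf fg].
have fK : cancel f g by exact: crowned_homotopic_id cI _ gf.
have gK : cancel g f by exact: crowned_homotopic_id cI' _ fg.
have fle : {homo f : x y / incidence_le x y}.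
  exact/continuous_incidence_homo/cts_fun.
have gle : {homo g : x y / incidence_le x y}.
  exact/continuous_incidence_homo/cts_fun.
have [fb [ft [fbE ftE ftI]]] := crowned_homo_levels cI (can_inj fK) fle.
have [gb [gt [gbE gtE gtI]]] := crowned_homo_levels cI' (can_inj gK) gle.
have fbK : cancel fb gb.
  by move=> b; have := fK (inl b); rewrite /= fbE gbE => -[].
have gbK : cancel gb fb.
  by move=> b; have := gK (inl b); rewrite /= gbE fbE => -[].
have ftK : cancel ft gt.
  by move=> t; have := fK (inr t); rewrite /= ftE gtE => -[].
have gtK : cancel gt ft.
  by move=> t; have := gK (inr t); rewrite /= gtE ftE => -[].
exists fb, gb, ft, gt; split=> //; split=> // b t.
by split=> [/ftI//|/gtI]; rewrite fbK ftK.
Qed.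

(** * Well-orders *)

Section well_order_facts.
Variables (V : eqType) (r : rel V).
Hypothesis wo_r : well_order r.

(** A [well_order] is given by unique least elements of nonempty sets. The order axioms follow from
    sets of two or three elements. *)
Lemma well_order_total : total r.
Proof.
move=> a b; have [|z [[]]] := wo_r (A := [pred x | (x == a) || (x == b)]).
  by exists a; rewrite inE eqxx.
rewrite inE => /orP[]/eqP-> zmin _.
  by rewrite zmin// inE eqxx orbT.
by rewrite (zmin a) ?orbT// inE eqxx.
Qed.

Lemma well_order_anti a b : r a b -> r b a -> a = b.
Proof.
move=> ab ba; have rxx x : r x x by have := well_order_total x x; rewrite orbb.
have [|z [_ zuniq]] := wo_r (A := [pred x | (x == a) || (x == b)]).
  by exists a; rewrite inE eqxx.
have za : z = a.
  apply: zuniq; split=> [|x]; rewrite inE ?eqxx//.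
  by move=> /orP[]/eqP->.
rewrite -za; apply: zuniq; split=> [|x]; rewrite inE ?eqxx ?orbT//.
by move=> /orP[]/eqP->.
Qed.

Lemma well_order_trans : transitive r.
Proof.
move=> b a c ab bc.
have [|z [[]]] := wo_r (A := [pred x | [|| x == a, x == b | x == c]]).
  by exists a; rewrite inE eqxx.
rewrite inE => /or3P[]/eqP-> zmin _.
- by rewrite zmin// inE eqxx !orbT.
- by rewrite (@well_order_anti a b)// zmin// inE eqxx.
- by rewrite -(@well_order_anti b c)// zmin// inE eqxx orbT.
Qed.

Lemma well_order_ind (P : V -> Prop) :
  (forall a, (forall b, ~~ r a b -> P b) -> P a) -> forall a, P a.
Proof.
move=> IH a; apply: contrapT => nPa.
have [|z [[]]] := wo_r (A := [pred x | `[< ~ P x >]]).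
  by exists a; apply/asboolP.
move=> /asboolP nPz zmin _; apply: nPz; apply: IH => b nzb.
apply: contrapT => nPb; move/negP: nzb; apply; apply: zmin.
exact/asboolP.
Qed.

End well_order_facts.

(** * Well-ordered labels with a finite tail *)

Section labels.
Variables (V : eqType) (r : rel V).
Hypothesis wo_r : well_order r.

(** With at least two tail elements, the first is neither the last label nor in [V]. In
    [cayley_automorphism] this separates it from the sources and shows that [Hub] is not sent to an
    arrow. *)
Definition label (n : nat) : Type := V + 'I_n.+2.

Definition label_le (m n : nat) (x : label m) (y : label n) : bool :=
  match x, y with
  | inl a, inl b => r a b
  | inl _, inr _ => true
  | inr _, inl _ => false
  | inr i, inr j => i <= j
  end.

Definition label_last (n : nat) : label n := inr ord_max.

Lemma label_le_refl n (x : label n) : label_le x x.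
Proof.
by case: x => [a|i] /=; [have := well_order_total wo_r a a; rewrite orbb|].
Qed.

Lemma label_le_last n (x : label n) : label_le x (label_last n).
Proof. by case: x => //= i; rewrite -ltnS. Qed.

Lemma label_le_anti n (x y : label n) : label_le x y -> label_le y x -> x = y.
Proof.
case: x y => [a|i] [b|j] //= xy yx; congr (_ _).
  exact: (well_order_anti wo_r).
by apply/val_inj/eqP; rewrite eqn_leq xy.
Qed.

Lemma label_le_trans n (y x z : label n) :
  label_le x y -> label_le y z -> label_le x z.
Proof.
case: x y z => [a|i] [b|j] [c|k] //=; first exact: well_order_trans.
exact: leq_trans.
Qed.

(* Otherwise [f x < x] for some least [x], and then [f (f x) < f x]: an
   order-reflecting map of well-orders never decreases. The comparison is
   between two types because both are initial segments of the same order. *)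
Lemma label_le_reflecting m n (f : label m -> label n) :
  (forall x y, label_le (f x) (f y) -> label_le x y) ->
  forall x, label_le x (f x).
Proof.
move=> f_refl.
have lel : forall a, label_le (inl a : label m) (f (inl a)).
  apply: (well_order_ind wo_r) => a IH.
  case fa: (f (inl a)) => [b|//] /=; apply: contrapT => /negP nab.
  move/negP: (nab); apply; apply: (f_refl (inl a) (inl b)).
  by rewrite fa; exact: IH.
case=> [//|[i]]; elim/ltn_ind: i => i IH im.
case fi: (f (inr (Ordinal im))) => [b|j] /=.
  by apply: (f_refl (inr (Ordinal im)) (inl b)); rewrite fi; exact: lel.
rewrite leqNgt; apply/negP => ji; have jm := ltn_trans ji im.
have := IH _ ji jm; have := f_refl (inr (Ordinal im)) (inr (Ordinal jm)).
by rewrite fi /= leqNgt ji => h /h.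
Qed.

(** The last label has tail index m + 1 and is not moved down, so its image has a tail index between
    m + 1 and n + 1. *)
Lemma label_iso_leq m n (f : label m -> label n) :
  (forall x y, label_le (f x) (f y) -> label_le x y) -> m <= n.
Proof.
move=> /label_le_reflecting/(_ (label_last m)).
by case: (f _) => //= j mj; rewrite -ltnS -ltnS (leq_trans _ (ltn_ord j)).
Qed.

(** Both [f] and [g] reflect the order, so neither decreases: x <= f x and f x <= g (f x). Applying
    [f] to the latter gives f (f x) <= f x, hence f x <= x. *)
Lemma label_iso_id n (f g : label n -> label n) : cancel g f ->
    (forall x y, label_le (f x) (f y) = label_le x y) ->
  f =1 id.
Proof.
move=> gK fle x; apply/esym/label_le_anti.
  by apply: label_le_reflecting => y z; rewrite fle.
have gfx : label_le (f x) (g (f x)).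
  by apply: label_le_reflecting => y z; rewrite -fle !gK.
by rewrite -fle gK fle in gfx.
Qed.

End labels.

(** * The coloured Cayley incidence and its automorphisms *)

Section cayley_incidence.
Variables (G : groupType) (r : rel G).
Hypothesis wo_r : well_order r.
Local Notation label := (label G).
Local Notation le := (label_le r).

(** This encodes the Cayley graph of [G] with all elements as generators. Vertices are doubled into
    sources and targets, so that the two ends of an arrow can be told apart. *)
Inductive cayley_bottom (n : nat) : Type :=
  | Label of label n | Source of G | Target of G.

Inductive cayley_top (n : nat) : Type :=
  | Cut of label n | Hub | Arrow of G & G.

Arguments Source {n}.
Arguments Target {n}.
Arguments Hub {n}.
Arguments Arrow {n}.

(* [Hub] puts labels and targets on crowns and tells labels from sources. The
   last label lies below [Hub] and all cuts, but below no arrow: otherwise, for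
   trivial G, the set below a cut could be included in the set below an
   arrow. *)
Definition cayley_incidence (n : nat) (b : cayley_bottom n)
    (t : cayley_top n) : Prop :=
  match b, t with
  | Label a, Cut w => le w a
  | Source _, Cut _ => True
  | Target _, Cut _ => False
  | Label _, Hub => True
  | Source _, Hub => False
  | Target _, Hub => True
  | Label a, Arrow g h => a = inl (g^-1 * h)%g
  | Source x, Arrow g _ => x = g
  | Target x, Arrow _ h => x = h
  end.

Local Notation I := (@cayley_incidence _).

(** Three families of crowns cover all points: two cuts over the last label and a source; a cut and
    [Hub] over two labels; [Hub] and an arrow over its target and its colour. *)
Lemma crowned_cayley n : crowned (@cayley_incidence n).
Proof.
pose s0 : label n := inl 1%g; pose lst := label_last G n.
have lelast := label_le_last r; have lerefl := label_le_refl wo_r.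
have cut_crown (g : G) (w w' : label n) : w <> w' ->
    crown I (Label lst) (Source g) (Cut w) (Cut w').
  by move=> ww'; split; split=> //; [case|exact: lelast|exact: lelast].
have hub_crown (a : label n) : a <> lst ->
    crown I (Label a) (Label lst) (Cut a) Hub.
  move=> an; split; split=> //; [by case|exact: lerefl|exact: lelast].
have arrow_crown (g h : G) :
    crown I (Target h) (Label (inl (g^-1 * h)%g)) Hub (Arrow g h) by split.
case=> [[a|g|h]|[w||g h]].
- have [->|an] := pselect (a = lst).
    exists (Label lst), (Source 1%g), (Cut s0), (Cut lst).
    by split; [exact: cut_crown|do 3 left].
  exists (Label a), (Label lst), (Cut a), Hub.
  by split; [exact: hub_crown|do 3 left].
- exists (Label lst), (Source g), (Cut s0), (Cut lst).
  by split; [exact: cut_crown|left; left; right].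
- exists (Target h), (Label (inl (1^-1 * h)%g)), Hub, (Arrow 1%g h).
  by split; [exact: arrow_crown|do 3 left].
- pose w' := if w is inl _ then lst else s0.
  exists (Label lst), (Source 1%g), (Cut w), (Cut w').
  by split; [apply: cut_crown; rewrite /w'; case: w {w'}|left; right].
- exists (Label s0), (Label lst), (Cut s0), Hub.
  by split; [exact: hub_crown|right].
- exists (Target h), (Label (inl (g^-1 * h)%g)), Hub, (Arrow g h).
  by split; [exact: arrow_crown|right].
Qed.

Let included n (t t' : cayley_top n) := forall b, I b t -> I b t'.

(* Recognizes the cuts among the maximal points from the incidence relation
   alone. *)
Lemma cayley_top_comparableP n (t : cayley_top n) :
  (exists2 t', t <> t' & included t t' \/ included t' t) <->
  exists w, t = Cut w.
Proof.
have lelast := label_le_last r; have lerefl := label_le_refl wo_r.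
have incl_cut (w w' : label n) : le w' w -> included (Cut w) (Cut w').
  by move=> w'w [a|g|h] //= wa; exact: (label_le_trans wo_r) wa.
split=> [[t' tt' ]|[w ->]]; last first.
  have [->|wF] := pselect (w = label_last G n).
    by exists (Cut (inl 1%g)) => //; left; exact: incl_cut.
  exists (Cut (label_last G n)); first by case.
  by right; apply: incl_cut; exact: lelast.
have hub_cut w : ~ @included n Hub (Cut w) by move/(_ (Target 1%g)); apply.
have cut_hub w : ~ @included n (Cut w) Hub by move/(_ (Source 1%g)); apply.
have hub_arrow g h : ~ @included n Hub (Arrow g h).
  by move/(_ (Label (label_last G n))) => /(_ Logic.I).
have arrow_hub g h : ~ @included n (Arrow g h) Hub.
  by move/(_ (Source g)); apply.
have cut_arrow w g h : ~ @included n (Cut w) (Arrow g h).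
  by move/(_ (Label (label_last G n)) (lelast _ _)).
have arrow_cut w g h : ~ @included n (Arrow g h) (Cut w).
  by move/(_ (Target h)); apply.
have arrow_arrow g h g' h' : @included n (Arrow g h) (Arrow g' h') ->
    Arrow g h = Arrow g' h' :> cayley_top n.
  by move=> gh; rewrite (gh (Source g) erefl) (gh (Target h) erefl).
case: t t' tt' => [w||g h] [w'||g' h'] // tt' tt'I; try by [exists w];
  exfalso; case: tt'I.
- exact: hub_cut.
- exact: cut_hub.
- exact: hub_arrow.
- exact: arrow_hub.
- exact: arrow_cut.
- exact: cut_arrow.
- exact: arrow_hub.
- exact: hub_arrow.
- by move/arrow_arrow.
- by move/arrow_arrow/esym.
Qed.

(** An isomorphism preserves comparability of the sets below maximal points, so it sends cuts to
    cuts. Inclusion between cuts is the reversed order of the labels, which is therefore preserved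
    too. *)
Lemma cayley_iso_cut m n fb gb ft gt :
    incidence_iso (@cayley_incidence m) (@cayley_incidence n) fb gb ft gt ->
  exists (fl : label m -> label n) gl, [/\ forall w, ft (Cut w) = Cut (fl w),
    cancel gl fl & forall x y, le (fl x) (fl y) = le x y].
Proof.
have cutP m' n' fb' gb' ft' gt' : incidence_iso (@cayley_incidence m')
    (@cayley_incidence n') fb' gb' ft' gt' ->
    forall w, exists w', ft' (Cut w) = Cut w'.
  case=> fbK gbK ftK gtK ft_I w; apply/cayley_top_comparableP.
  have /cayley_top_comparableP[t' wt' cmp] : exists w', Cut w = Cut w'.
    by exists w.
  exists (ft' t') => [/(can_inj ftK)//|].
  by case: cmp => cmp; [left|right] => b; rewrite -(gbK b) -!ft_I; exact: cmp.
move=> iso; have isoV := incidence_iso_sym iso.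
have [fl flE] := choice (cutP _ _ _ _ _ _ iso).
have [gl glE] := choice (cutP _ _ _ _ _ _ isoV).
case: iso => fbK gbK ftK gtK ft_I.
have glK : cancel gl fl.
  by move=> w; have := gtK (Cut w); rewrite glE flE => -[].
have cut_incl n' (x y : label n') : le x y <-> included (Cut y) (Cut x).
  split=> [xy [a|g|h] //= ya|/(_ (Label y))].
    exact: (label_le_trans wo_r) ya.
  by apply; exact: label_le_refl.
exists fl, gl; split=> // x y.
apply/idP/idP => /cut_incl xy; apply/cut_incl => b.
  by rewrite !ft_I !flE; exact: xy.
by rewrite -(gbK b) -!flE -!ft_I; exact: xy.
Qed.

Definition shift_bottom n (c : G) (b : cayley_bottom n) : cayley_bottom n :=
  match b with
  | Label a => Label a
  | Source g => Source (c * g)%g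
  | Target h => Target (c * h)%g
  end.

Definition shift_top n (c : G) (t : cayley_top n) : cayley_top n :=
  match t with
  | Cut w => Cut w
  | Hub => Hub
  | Arrow g h => Arrow (c * g)%g (c * h)%g
  end.

Lemma shift_incidence n c (b : cayley_bottom n) (t : cayley_top n) :
  I b t -> I (shift_bottom c b) (shift_top c t).
Proof.
case: b t => [a|g|h] [w||x y] //=; try by move=> ->.
by move=> ->; rewrite invgM -mulgA mulKg.
Qed.

(** The cuts are fixed because the labels are rigid. The kinds of the other points are then
    recovered one after another, and the colours of the arrows force a left translation. *)
Lemma cayley_automorphism n fb gb ft gt :
    incidence_iso (@cayley_incidence n) (@cayley_incidence n) fb gb ft gt ->
  exists c, fb =1 shift_bottom c /\ ft =1 shift_top c.
Proof.
move=> iso; have [fl [gl [ftE glK fle]]] := cayley_iso_cut iso.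
have cutE w : ft (Cut w) = Cut w by rewrite ftE (label_iso_id wo_r glK fle).
case: iso => _ _ ftK _ ft_I.
have lerefl := label_le_refl wo_r.
have below_cut b w : I (fb b) (Cut w) <-> I b (Cut w).
  by rewrite (ft_I b) cutE.
have not_cut t w : ft t = Cut w -> t = Cut w.
  by move=> tw; apply: (can_inj ftK); rewrite cutE.
(* Targets are exactly the bottom points below no cut. *)
have targetE h : exists h', fb (Target h) = Target h'.
  have := below_cut (Target h); case: (fb _) => [a|g|h'] bc; last by exists h'.
    by have [/(_ (lerefl _ a))] := bc a.
  by have [/(_ Logic.I)] := bc (inl 1%g).
(* The cuts above a label determine it among labels, but the last label and the sources lie below
   the same cuts. *)
have labelE a : (forall g, fb (Label a) <> Source g) ->
    fb (Label a) = Label a.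
  have := below_cut (Label a); case: (fb _) => [a'|g|h] bc nsource.
  - congr Label; apply: (label_le_anti wo_r).
      by apply/(bc a'); exact: lerefl.
    by apply/(bc a); exact: lerefl.
  - by case: (nsource g).
  - by have [_ /(_ (lerefl _ a))] := bc a.
(* The first tail element is not below the last cut, whereas every source is. *)
have label0E : fb (Label (inr ord0)) = Label (inr ord0).
  apply: labelE => g lg.
  have := below_cut (Label (inr ord0)) (label_last G n).
  by rewrite lg => -[/(_ Logic.I)].
(* The image of [Hub] is above the first tail element, which is below no arrow. *)
have hubE : ft Hub = Hub.
  have := ft_I (Label (inr ord0)) Hub; rewrite label0E//.
  case fh : (ft Hub) => [w||g h] //=; first by move/not_cut : fh.
  by case=> /(_ Logic.I).
have {label0E}labelE a : fb (Label a) = Label a.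
  apply: labelE => g ag.
  by have := ft_I (Label a) Hub; rewrite hubE ag => -[/(_ Logic.I)].
have sourceE g : exists g', fb (Source g) = Source g'.
  have := ft_I (Source g) Hub; rewrite hubE.
  by case: (fb _) => [a|g'|h] /= [_ sg]; [case: sg| exists g'|case: sg].
have arrowE g h : exists g' h', ft (Arrow g h) = Arrow g' h'.
  case fa : (ft (Arrow g h)) => [w||g' h']; last by exists g', h'.
    by move/not_cut : fa.
  by have := can_inj ftK (etrans fa (esym hubE)).
have arrowI g h : exists g' h', [/\ ft (Arrow g h) = Arrow g' h',
    fb (Source g) = Source g', fb (Target h) = Target h' &
    (g^-1 * h = g'^-1 * h')%g].
  have [g' [h' gh']] := arrowE g h; exists g', h'; split=> //.
  - have [x gx] := sourceE g.
    have [/(_ erefl) + _] := ft_I (Source g) (Arrow g h).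
    by rewrite gx gh' /= => ->.
  - have [x hx] := targetE h.
    have [/(_ erefl) + _] := ft_I (Target h) (Arrow g h).
    by rewrite hx gh' /= => ->.
  - have [/(_ erefl) + _] := ft_I (Label (inl (g^-1 * h)%g)) (Arrow g h).
    by rewrite labelE gh' /= => -[].
(* The translation is read off at the source 1. The arrows from 1 then determine the targets, and
   the colours of all arrows determine their sources. *)
have [c s1] := sourceE 1%g; exists c.
have tE h : fb (Target h) = Target (c * h)%g.
  have [g' [h' [_ + -> +]]] := arrowI 1%g h.
  by rewrite s1 => -[<-]; rewrite invg1 mul1g => ->; rewrite mulVKg.
have aE g h : ft (Arrow g h) = Arrow (c * g)%g (c * h)%g.
  have [g' [h' [-> _ + +]]] := arrowI g h.
  rewrite tE => -[<-]; rewrite mulgA => /mulIg gc.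
  by rewrite -[g]invgK gc invgM invgK mulVKg.
split=> [[a|g|h]|[w||g h]] //=.
by have [g' [h' [+ -> _ _]]] := arrowI g g; rewrite aE => -[<-].
Qed.

End cayley_incidence.

(** * The Cayley spaces and their groups of self-equivalences *)

Section cayley_space.
Variables (R : realType) (G : groupType) (r : rel G).
Hypothesis wo_r : well_order r.

Definition cayley_space (n : nat) : topologicalType :=
  incidence_space (@cayley_incidence G r n).

Lemma cayley_space_leq m n :
  homotopy_equivalent R (cayley_space m) (cayley_space n) -> m <= n.
Proof.
move=> [f [g fg]].
have [fb [gb [ft [gt [iso _ _]]]]] := homotopy_inverse_incidence_iso
  (@crowned_cayley G r wo_r m) (@crowned_cayley G r wo_r n) fg.
have [fl [_ [_ _ fle]]] := cayley_iso_cut wo_r iso.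
by apply: (label_iso_leq wo_r (f := fl)) => x y; rewrite fle.
Qed.

Section shifts.
Variable n : nat.
Local Notation X := (cayley_space n).

Definition shift (c : G) (x : X) : X :=
  match x with
  | inl b => inl (shift_bottom c b)
  | inr t => inr (shift_top c t)
  end.

Lemma shift_continuous c : continuous (shift c).
Proof.
apply/continuous_incidence_homo => x y [->|]; first exact: incidence_le_refl.
case: x y => [b|//] [//|t] bt; apply/incidence_lebt; exact: shift_incidence.
Qed.

HB.instance Definition _ c := isContinuous.Build X X (shift c)
  (@shift_continuous c).

Lemma shift1 : shift 1 =1 id.
Proof. by case=> [[]|[]] * /=; rewrite ?mul1g. Qed.

Lemma shiftM c d : shift (c * d) =1 shift c \o shift d.
Proof. by case=> [[]|[]] * /=; rewrite ?mulgA. Qed.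

Lemma shift_hequivP c :
  `[< homotopy_equivalence R (shift c : continuousType X X) >].
Proof.
apply/asboolP; exists (shift c^-1 : continuousType X X).
have hom d e : (d * e)%g = 1%g -> homotopic R (shift d \o shift e) idfun.
  move=> de; rewrite (_ : _ \o _ = idfun); first exact/homotopic_refl/cts_fun.
  by apply/funext => x; rewrite -shiftM de shift1.
by split; apply: hom; rewrite ?mulVg ?mulgV.
Qed.

Definition shift_class (c : G) : selfHE R X :=
  \pi_(selfHE R X)%qT
    (exist _ (shift c : continuousType X X) (shift_hequivP c)).

Lemma shift_classM c d :
  shift_class (c * d) = (shift_class c * shift_class d)%g.
Proof.
rewrite [RHS]selfHE_mul_pi; apply/selfHE_eqP => /=.
rewrite (_ : shift (c * d) = shift c \o shift d); last exact/funext/shiftM.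
exact/homotopic_refl/cts_fun.
Qed.

Lemma shift_class_inj : injective shift_class.
Proof.
move=> c d /selfHE_eqP/(crowned_homotopic_eq (@crowned_cayley G r wo_r n)).
(* Homotopic shifts are equal as maps, and the value at the source 1 recovers the group element. *)
by move/(_ (inl (Source n 1%g))) => /= -[]; rewrite !mulg1.
Qed.

Lemma shift_class_surj a : exists c, shift_class c = a.
Proof.
elim/quotW: a => f; have fg := selfHequiv_invP f.
have [fb [gb [ft [gt [iso fbE ftE]]]]] := homotopy_inverse_incidence_iso
  (@crowned_cayley G r wo_r n) (@crowned_cayley G r wo_r n) fg.
have [c [fbc ftc]] := cayley_automorphism wo_r iso.
exists c; apply/selfHE_eqP => /=.
rewrite (_ : shift c = val f); first exact/homotopic_refl/cts_fun.
by apply/funext => -[b|t] /=; rewrite ?fbE ?ftE ?fbc ?ftc.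
Qed.

Lemma selfHE_cayley_space : group_isomorphic (selfHE R X) G.
Proof.
have [phi phiK] := choice shift_class_surj.
have shiftK := inj_can_sym phiK shift_class_inj.
exists phi; last by exists shift_class.
by move=> x y; apply: shift_class_inj; rewrite shift_classM !phiK.
Qed.

End shifts.

End cayley_space.

Theorem theorem1p3 (R : realType) (G : groupType) :
  exists X : nat -> topologicalType,
    [/\ forall n, alexandroff (X n),
        forall m n, m <> n -> ~ homotopy_equivalent R (X m) (X n)
      & forall n, group_isomorphic (selfHE R (X n)) G].
Proof.
have [r wo_r] := well_ordering_principle G.
exists (cayley_space r); split=> [n|m n mn hmn|n].
- exact: alexandroff_incidence.
- have hnm : homotopy_equivalent R (cayley_space r n) (cayley_space r m).
    by have [f [g [gf fg]]] := hmn; exists g, f.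
  apply: mn; apply/eqP; rewrite eqn_leq.
  by rewrite (cayley_space_leq wo_r hmn) (cayley_space_leq wo_r hnm).
- exact: selfHE_cayley_space.
Qed.
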